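(* For $n \geq 5$, let $G_n := (\mathbb{Z}/2\mathbb{Z})^n \times (\mathbb{Z}/4\mathbb{Z})^n$ and $H_n := (\mathbb{Z}/2\mathbb{Z})^{n-2}\times(\mathbb{Z}/4\mathbb{Z})^{n+1}$. Then $G_n \not\cong H_n$, $|G_n| = |H_n|$, and the $n/4$-dimensional count-free WL Version II algorithm (run for any number of rounds) does not distinguish $G_n$ from $H_n$.
   Context: Count-free WL Version II for groups, dimension $k$: $k$-tuples $(g_1,\dots,g_k)$ and $(h_1,\dots,h_k)$ get the same initial color iff $g_i\mapsto h_i$ extends to an isomorphism $\langle g_1,\dots,g_k\rangle\to\langle h_1,\dots,h_k\rangle$; refinement is $\chi_{t+1}(\bar g) = (\chi_t(\bar g), \{(\chi_t(\bar g(g_1/x)),\dots,\chi_t(\bar g(g_k/x))) : x \in G\})$ with a set (not multiset) of color tuples, where $\bar g(g_i/x)$ replaces the $i$-th entry by $x$. Two groups are distinguished if their orders differ or the sets of colors of their $k$-tuples differ at some round. *)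

(* Defs.v *)
From HB Require Import structures.
From mathcomp Require Import all_boot all_order all_algebra all_fingroup all_solvable.

Set Implicit Arguments.
Unset Strict Implicit.
Unset Printing Implicit Defensive.

Section CountFreeWL.

Variable k : nat.

Section MarkedIsomorphism.
Variables aT bT : finGroupType.

Definition marked_isog (g : k.-tuple aT) (h : k.-tuple bT) : bool :=
  [exists f : {ffun aT -> bT},
     misom <<[set x in g]>> <<[set y in h]>> f
     && [forall i : 'I_k, f (tnth g i) == tnth h i]].

End MarkedIsomorphism.

Definition tuple_subst (T : Type) (g : k.-tuple T) (i : 'I_k) (x : T) :
    k.-tuple T :=
  [tuple if j == i then x else tnth g j | j < k].

Fixpoint wl_color (C : finType) (t : nat) : finType :=
  if t is t'.+1 then
    (wl_color C t' * {set k.-tuple (wl_color C t')})%type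
  else C.

Fixpoint wl_refine (C : finType) (aT : finGroupType) (chi0 : k.-tuple aT -> C)
    (t : nat) : k.-tuple aT -> wl_color C t :=
  match t return k.-tuple aT -> wl_color C t with
  | 0 => chi0
  | t'.+1 => fun g =>
      let chi := wl_refine chi0 t' in
      (chi g, [set [tuple chi (tuple_subst g i x) | i < k] | x : aT])
  end.

Section TwoGroups.
Variables gT hT : finGroupType.

(* The two groups are coloured simultaneously, so that colours of tuples from
   different groups can be compared.  The initial colour of a tuple is its
   equivalence class under marked isomorphism, among all k-tuples of both
   groups. *)
Definition wl2_color0 : finType := {set k.-tuple gT + k.-tuple hT}.

Definition wl2_init (aT : finGroupType) (a : k.-tuple aT) : wl2_color0 :=
  [set u : k.-tuple gT + k.-tuple hT |
     match u with
     | inl g => marked_isog a g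
     | inr h => marked_isog a h
     end].

Definition wl2_chi (aT : finGroupType) (t : nat) :
    k.-tuple aT -> wl_color wl2_color0 t :=
  wl_refine (@wl2_init aT) t.

Definition wl2_distinguishes : Prop :=
  #|gT| <> #|hT| \/
  exists t : nat,
    [set wl2_chi t g | g : k.-tuple gT] <> [set wl2_chi t h | h : k.-tuple hT].

End TwoGroups.

End CountFreeWL.

Definition Gn (n : nat) : finGroupType := ('rV['Z_2]_n * 'rV['Z_4]_n)%type.
Definition Hn (n : nat) : finGroupType :=
  ('rV['Z_2]_(n - 2) * 'rV['Z_4]_(n + 1))%type.

(* Main.v *)
(** Duplicator wins the count-free pebble game by keeping the subgroup R of
    G x H generated by the pebbled pairs the graph of an isomorphism A -> B that
    also preserves squareness in G and in H.  Such an R can be extended by any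
    x in G: its partner has to avoid B, or B * squares(H), inside the squares or
    inside a coset of the elements of order at most 2.  This is possible because
    #|B| <= 4^k while there are at least 2^n squares and the index of the squares
    among the elements of order at most 2 is at least 2^(n-2).  The groups
    themselves differ in the number of elements of order at most 2. *)
Require Import Defs.
From mathcomp Require Import all_boot all_order all_algebra all_fingroup all_solvable.
From mathcomp Require Import zify.

Set Implicit Arguments.
Unset Strict Implicit.
Unset Printing Implicit Defensive.
Import GroupScope.

(** * Marked isomorphism as an equivalence across different groups *)

Section MarkedIsog.
Variable k : nat.

Lemma marked_isogP (aT bT : finGroupType) (g : k.-tuple aT) (h : k.-tuple bT) :
  reflect (exists2 f : {morphism <<[set x in g]>> >-> bT},
             isom <<[set x in g]>> <<[set y in h]>> f
           & forall i, f (tnth g i) = tnth h i)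
          (marked_isog g h).
Proof.
apply: (iffP existsP) => [[f /andP[/misomP[fM isof] /forallP fgh]]|[f isof fgh]].
  exists (morphm_morphism fM) => // i.
  exact/eqP/fgh.
exists [ffun x => f x]; apply/andP; split; last first.
  by apply/forallP => i; rewrite ffunE fgh.
have fM : morphic <<[set x in g]>> [ffun x => f x].
  by apply/morphicP => x y Gx Gy; rewrite !ffunE morphM.
apply/misomP; exists fM; move: isof => /isomP[injf imf]; apply/isomP; split.
  apply/injmP => x y Gx Gy; rewrite /= /morphm !ffunE.
  exact: (injmP injf).
rewrite -imf !morphimEdom; apply: eq_imset => x.
by rewrite /= /morphm ffunE.
Qed.

Lemma tnth_gen (aT : finGroupType) (g : k.-tuple aT) i :
  tnth g i \in <<[set x in g]>>.
Proof. by rewrite mem_gen // inE mem_tnth. Qed.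

Lemma marked_isog_sym (aT bT : finGroupType) (g : k.-tuple aT)
    (h : k.-tuple bT) :
  marked_isog g h -> marked_isog h g.
Proof.
case/marked_isogP=> f isof fgh; apply/marked_isogP.
exists (isom_inv isof); first exact: isom_sym.
by move=> i; rewrite /= /restrm -fgh invmE ?tnth_gen.
Qed.

(** Three different groups are allowed so that tuples of two groups can later be compared through a
    tuple of their product. *)
Lemma marked_isog_trans (aT bT cT : finGroupType) (g : k.-tuple aT)
    (h : k.-tuple bT) (l : k.-tuple cT) :
  marked_isog g h -> marked_isog h l -> marked_isog g l.
Proof.
case/marked_isogP=> f1 iso1 fgh /marked_isogP[f2 iso2 fhl].
have sG12: <<[set x in g]>> \subset f1 @*^-1 <<[set x in h]>>.
  by rewrite -(isom_im iso1) -sub_morphim_pre.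
apply/marked_isogP; exists (restrm sG12 (f2 \o f1)); last first.
  by move=> i; rewrite /= /restrm /= fgh fhl.
apply/isomP; split.
  by rewrite injm_restrm // injm_comp ?(isom_inj iso1) ?(isom_inj iso2).
by rewrite morphim_restrm setIid morphim_comp (isom_im iso1) (isom_im iso2).
Qed.

Lemma wl2_init_marked_isog (gT hT aT bT : finGroupType) (g : k.-tuple aT)
    (h : k.-tuple bT) :
  marked_isog g h -> wl2_init gT hT g = wl2_init gT hT h.
Proof.
move=> gh; have hg := marked_isog_sym gh.
by apply/setP=> -[u|u]; rewrite !inE; apply/idP/idP;
  [apply: marked_isog_trans hg | apply: marked_isog_trans gh
  |apply: marked_isog_trans hg | apply: marked_isog_trans gh].
Qed.

End MarkedIsog.

(** * Squares and 2-torsion in abelian groups of exponent dividing 4 *)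

Definition squares (T : finGroupType) : {set T} := [set x ^+ 2 | x : T].

(** The identity is included: in a commutative group this is the whole 2-torsion subgroup. *)
Definition involutions (T : finGroupType) : {set T} := [set x : T | x ^+ 2 == 1].

(* On a matched subgroup both projections are injective, so it is the graph of
   an isomorphism that preserves and reflects being a square in the whole group. *)
Definition matched (aT bT : finGroupType) (R : {set aT * bT}) :=
  forall p, p \in R ->
    (p.1 == 1) = (p.2 == 1) /\ (p.1 \in squares aT) = (p.2 \in squares bT).

Lemma leq_card_mulg (T : finGroupType) (A B : {set T}) :
  (#|(A * B)%g| <= #|A| * #|B|)%N.
Proof.
have ->: A * B = mulg @2: (A, B) by [].
by rewrite curry_imset2X -cardsX leq_imset_card.
Qed.

Section Exponent4.
Variable T : finGroupType.
Hypothesis TC : forall x y : T, x * y = y * x.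
Hypothesis T4 : forall x : T, x ^+ 4 = 1.

Lemma expMg2 (x y : T) : (x * y) ^+ 2 = x ^+ 2 * y ^+ 2.
Proof. by rewrite expgMn //; apply: TC. Qed.

Lemma square1 : 1 \in squares T.
Proof. by apply/imsetP; exists 1; rewrite ?expg1n. Qed.

Lemma squareX2 (x : T) : x ^+ 2 \in squares T.
Proof. exact: imset_f. Qed.

Lemma square_expg2 (s : T) : s \in squares T -> s ^+ 2 = 1.
Proof. by case/imsetP=> x _ ->; rewrite -expgM T4. Qed.

Lemma squaresMr (x s : T) :
  s \in squares T -> (x * s \in squares T) = (x \in squares T).
Proof.
case/imsetP=> z _ ->; apply/imsetP/imsetP=> -[y _ Ey].
  by exists (y * z^-1); rewrite // expMg2 -Ey expgVn mulgK.
by exists (y * z); rewrite // expMg2 -Ey.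
Qed.

End Exponent4.

(** * Extending a matched subgroup by one pair *)

Section Extension.
Variables aT bT : finGroupType.
Hypothesis aC : forall x y : aT, x * y = y * x.
Hypothesis bC : forall x y : bT, x * y = y * x.
Hypothesis a4 : forall x : aT, x ^+ 4 = 1.
Hypothesis b4 : forall x : bT, x ^+ 4 = 1.
Implicit Types (R : {group aT * bT}) (p : aT * bT).

Lemma pair_commute p q : p * q = q * p.
Proof. by case: p q => a b [c d]; congr pair; [apply: aC | apply: bC]. Qed.

Lemma pair_expgE (x : aT) (y : bT) n : (x, y) ^+ n = (x ^+ n, y ^+ n).
Proof. by elim: n => // n IHn; rewrite !expgS IHn. Qed.

(** As [p ^+ 2] lies in [R], adjoining [p] adds at most the coset [R * p], so being matched has to
    be rechecked only there. *)
Lemma joing_cycle_square R p q : p ^+ 2 \in R -> q \in R <*> <[p]> ->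
  q \in R \/ exists2 r, r \in R & q = r * p.
Proof.
move=> p2; rewrite norm_joinEr; last first.
  by apply/subsetP=> u _; apply/normP; apply/setP=> v;
     rewrite mem_conjg conjgE invgK pair_commute mulgVK.
case/mulsgP=> r _ Rr /cycleP[j ->] ->.
rewrite -(odd_double_half j) expgD -mul2n expgM.
have R2 : (p ^+ 2) ^+ j./2 \in R by rewrite groupX.
case: (odd j); rewrite /= ?mul1g ?expg1.
  right; exists (r * (p ^+ 2) ^+ j./2); first by rewrite groupM.
  by rewrite -mulgA; congr mulg; apply: pair_commute.
by left; rewrite groupM.
Qed.

(** The square of a partner of [x] must be the partner of [x ^+ 2]; [z] witnesses that this partner
    is a square. The size bound yields a square outside [snd @: R], and the non-inclusion yields an
    element of [involutions bT] that moves [z] off the product of [snd @: R] and [squares bT]. *)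
Lemma matched_join_square R (x : aT) (z : bT) :
    matched R -> (x ^+ 2, z ^+ 2) \in R ->
    (#|snd @: R| < #|squares bT|)%N ->
    ~~ (involutions bT \subset (snd @: R) * squares bT) ->
  exists y, matched (R <*> <[(x, y)]>).
Proof.
move=> mR Rxz ltB nsub.
have key y : (x ^+ 2, y ^+ 2) \in R ->
    (forall a b, (a, b) \in R -> (a * x == 1) = (b * y == 1) /\
        (a * x \in squares aT) = (b * y \in squares bT)) ->
    exists y, matched (R <*> <[(x, y)]>).
  move=> Rxy H; exists y => q /(joing_cycle_square _)[]; rewrite ?pair_expgE //.
    exact: mR.
  by case=> -[a b] Rab ->; apply: H.
(* If [x] is already a first coordinate in [R], its partner is forced and the subgroup does not
   grow. *)
case: (boolP (x \in fst @: R)) => [/imsetP[[a b] /= Rab xa] | nAx].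
  subst a; apply: (key b) => [|c d Rcd].
    by rewrite -pair_expgE groupX.
  by apply: (mR (c * x, d * b)); apply: (groupM Rcd Rab).
have nA a b : (a, b) \in R -> (a * x == 1) = false.
  move=> Rab; apply: contraNF nAx => /eqP ax1; apply/imsetP; exists (a, b)^-1.
    by rewrite groupV.
  by apply: (mulgI a); rewrite ax1 /= mulgV.
have nB y b a : y \notin snd @: R -> (a, b) \in R -> (b * y == 1) = false.
  move=> nBy Rab; apply: contraNF nBy => /eqP by1; apply/imsetP.
  exists (a, b)^-1; first by rewrite groupV.
  by apply: (mulgI b); rewrite by1 /= mulgV.
(* If x lies in fst R * squares, its partner is taken in snd R * squares, and
   outside of it otherwise. *)
case: (boolP [exists r in R, r.1 * x \in squares aT]) => [|none].
  case/existsP=> -[a0 b0] /= /andP[R0 a0x].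
  have [s Ss nBs]: exists2 s, s \in squares bT & s \notin snd @: R.
    by apply/subsetPn; apply: contraL ltB => /subset_leq_card; rewrite -leqNgt.
  have x2 : x ^+ 2 = (a0 ^+ 2)^-1.
    by apply: (mulgI (a0 ^+ 2)); rewrite mulgV -expMg2 // square_expg2.
  (* Since [s ^+ 2 = 1], this partner has the square of [b0^-1], just as [x] has that of [a0^-1].
     Taking [s] outside [snd @: R] keeps the identity out of the new coset. *)
  apply: (key (b0^-1 * s)) => [|a b Rab].
    rewrite x2 (expMg2 bC) (square_expg2 b4 Ss) mulg1 expgVn.
    have /= := groupVr (groupX 2 R0); rewrite pair_expgE; exact.
  have Rd : (a * a0^-1, b * b0^-1) \in R by apply: (groupM Rab (groupVr R0)).
  rewrite mulgA (nA _ _ Rab) (nB s _ _ nBs Rd); split=> //.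
  rewrite (squaresMr bC) //; have [_ /= <-] := mR _ Rd.
  have ->: a * x = a * a0^-1 * (a0 * x) by rewrite mulgA mulgVK.
  exact: squaresMr.
have [y y2 nBy]: exists2 y, y ^+ 2 = z ^+ 2 & y \notin (snd @: R) * squares bT.
  case: (boolP (z \in (snd @: R) * squares bT)); last by exists z.
  case/mulsgP=> b s Bb Ss ->.
  have /subsetPn[w] := nsub; rewrite inE => /eqP w2 nBw.
  (* The witness is [z * w]. Its square is that of [z] because [w ^+ 2 = 1], and if it lay in the
     excluded product then so would [w], since [z] does. *)
  exists (b * s * w); first by rewrite expMg2 // w2 mulg1.
  apply: contra nBw => /mulsgP[c u /imsetP[[c1 c2] Rc /= ->] Su E].
  case/imsetP: Bb => -[b1 b2] Rb /= Eb; subst b.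
  apply/mulsgP; exists (b2^-1 * c2) (u * s).
  - apply/imsetP; exists ((b1, b2)^-1 * (c1, c2)) => //.
    by rewrite groupM ?groupV.
  - by rewrite (squaresMr bC).
  have sV : s^-1 = s.
    by apply: (mulgI s); rewrite mulgV -(square_expg2 b4 Ss) expgS expg1.
  by rewrite -[w](mulKg (b2 * s)) E invMg sV -!mulgA (bC s) !mulgA.
apply: (key y) => [|a b Rab]; first by rewrite y2.
have Bb1 : b^-1 \in snd @: R by apply/imsetP; exists (a, b)^-1; rewrite ?groupV.
have nby : b * y \notin squares bT.
  apply: contra nBy => Sby; apply/mulsgP; exists b^-1 (b * y) => //.
  by rewrite mulKg.
split.
  rewrite (nA _ _ Rab); apply/esym; apply: contraNF nby => /eqP->.
  exact: square1.
rewrite (negPf nby); apply: contraNF none => Sax.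
by apply/existsP; exists (a, b); rewrite Rab.
Qed.

(* The square x ^+ 2 is added first, so that x itself falls under
   matched_join_square: the partner of x ^+ 2 is again a square z ^+ 2.  The
   extra square does not enlarge the image of R modulo squares, which is why the
   second bound involves #|R| only. *)
Lemma matched_extension R (x : aT) :
    matched R -> (2 * #|R| < #|squares bT|)%N ->
    (#|R| * #|squares bT| < #|involutions bT|)%N ->
  exists y, matched (R <*> <[(x, y)]>).
Proof.
move=> mR lt1 lt2.
have nsub : ~~ (involutions bT \subset (snd @: R) * squares bT).
  apply: contraL lt2 => /subset_leq_card; rewrite -leqNgt => /leq_trans; apply.
  rewrite (leq_trans (leq_card_mulg _ _)) //.
  by rewrite leq_mul2r leq_imset_card orbT.
(* The choice [z = 1] works here because [(x ^+ 2) ^+ 2 = 1]. *)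
have [|||y' mR'] := @matched_join_square R (x ^+ 2) 1 mR.
- by rewrite -expgM a4 expg1n group1.
- apply: leq_ltn_trans (leq_imset_card _ _) (leq_ltn_trans _ lt1).
  by rewrite leq_pmull.
- exact: nsub.
have Rp : (x ^+ 2, y') \in R <*> <[(x ^+ 2, y')]>.
  by rewrite mem_gen // inE cycle_id orbT.
have [_ /= /esym] := mR' _ Rp; rewrite squareX2 => Sy'.
have /imsetP[z _ Ez] := Sy'; subst y'.
have R2 : (x ^+ 2, z ^+ 2) ^+ 2 \in R.
  by rewrite pair_expgE -!expgM a4 b4 group1.
have [||y mR''] := @matched_join_square _ x z mR' Rp.
- apply: leq_ltn_trans (leq_imset_card _ _) (leq_ltn_trans _ lt1).
  have /subset_leq_card/leq_trans->// : R <*> <[(x ^+ 2, z ^+ 2)]> \subset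
     (R : {set _}) :|: [set r * (x ^+ 2, z ^+ 2) | r in R].
    apply/subsetP=> q /(joing_cycle_square R2)[Rq|[r Rr ->]]; rewrite inE ?Rq //.
    by apply/orP; right; apply/imsetP; exists r.
  rewrite (leq_trans (leq_card_setU _ _)) // mul2n -addnn.
  by rewrite leq_add2l leq_imset_card.
- apply: contra nsub => /subset_trans; apply; apply/subsetP=> v.
  case/mulsgP=> _ s /imsetP[q /(joing_cycle_square R2)[Rq|[r Rr ->]] ->] Ss ->.
    by rewrite mem_mulg ?imset_f.
  rewrite -mulgA mem_mulg ?imset_f // (squaresMr bC) //.
exists y => q Rq; apply: mR''; move: q Rq; apply/subsetP.
by rewrite genS // setSU // joing_subl.
Qed.

End Extension.
Lemma card_gen_exponent4 (T : finGroupType) (s : seq T) :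
    (forall x y : T, x * y = y * x) -> (forall x : T, x ^+ 4 = 1) ->
  (#|<<[set x in s]>>| <= 4 ^ size s)%N.
Proof.
move=> TC T4; elim: s => [|x s IHs].
  by rewrite set_nil gen0 cards1.
rewrite set_cons -joingE -joing_idr -joing_idl norm_joinEr; last first.
  by apply/subsetP=> u _; apply/normP; apply/setP=> v;
     rewrite mem_conjg conjgE invgK TC mulgVK.
rewrite expnS (leq_trans (leq_card_mulg _ _)) // leq_mul //.
by rewrite dvdn_leq // order_dvdn T4.
Qed.

Lemma marked_isog_map (k : nat) (aT bT : finGroupType)
    (f : {morphism [set: aT] >-> bT}) (w : k.-tuple aT) :
    {in <<[set x in w]>>, forall x, f x = 1 -> x = 1} ->
  marked_isog w (map_tuple f w).
Proof.
move=> f1; apply/marked_isogP.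
exists (restrm (subsetT <<[set x in w]>>) f); last by move=> i; rewrite tnth_map.
apply/isomP; split.
  apply/subsetP=> x; rewrite ker_restrm inE => /andP[Gx kx].
  by rewrite inE; apply/eqP/f1 => //; apply: mker kx.
rewrite morphim_restrm setIid morphim_gen ?subsetT // morphimEsub ?subsetT //.
congr <<_>>; apply/setP=> y; rewrite inE /=.
apply/imsetP/mapP=> -[x xw ->]; exists x => //;
  by rewrite inE in xw *.
Qed.

(** * From one-step extensions to equal colours *)

Section Pebbles.
Variables (k : nat) (gT hT aT bT : finGroupType).

Lemma matchedS (A B : {set aT * bT}) : A \subset B -> matched B -> matched A.
Proof. by move=> /subsetP sAB mB p /sAB/mB. Qed.

(** The tuple [w] of the product group serves as the middle term: being matched makes both
    projections injective on the subgroup that it generates. *)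
Lemma matched_marked_isog (w : k.-tuple (aT * bT)) :
  matched <<[set p in w]>> ->
  marked_isog (map_tuple fst w) (map_tuple snd w).
Proof.
move=> mw; apply: (marked_isog_trans (h := w)); first apply: marked_isog_sym.
  apply: (marked_isog_map (f := fst_morphism aT bT)) => -[a b] Rp /= a1.
  by have [/= + _] := mw _ Rp; rewrite a1 eqxx => /esym/eqP->.
apply: (marked_isog_map (f := snd_morphism aT bT)) => -[a b] Rp /= b1.
by have [/= + _] := mw _ Rp; rewrite b1 eqxx => /eqP->.
Qed.

Lemma map_tuple_subst (S T : Type) (f : S -> T) (w : k.-tuple S) i x :
  map_tuple f (tuple_subst w i x) = tuple_subst (map_tuple f w) i (f x).
Proof.
by apply: eq_from_tnth => j; rewrite !(tnth_map, tnth_mktuple); case: eqP.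
Qed.

(** The new pair is adjoined before the old one is dropped. One partner thus serves all positions
    [i] at once, as refinement requires: it records all substitutions of the same element
    together. *)
Lemma matched_subst (w : k.-tuple (aT * bT)) i p :
  matched <<[set q in p :: w]>> -> matched <<[set q in tuple_subst w i p]>>.
Proof.
apply: matchedS; apply: genS; apply/subsetP=> q; rewrite !inE.
by case/tnthP=> j ->; rewrite tnth_mktuple; case: ifP;
  rewrite ?eqxx ?mem_tnth ?orbT.
Qed.

Hypothesis forth : forall s : seq (aT * bT), (size s <= k)%N ->
  matched <<[set p in s]>> ->
  forall x, exists y, matched <<[set p in (x, y) :: s]>>.
Hypothesis back : forall s : seq (aT * bT), (size s <= k)%N ->
  matched <<[set p in s]>> ->
  forall y, exists x, matched <<[set p in (x, y) :: s]>>.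

Lemma wl2_chi_matched t (w : k.-tuple (aT * bT)) :
  matched <<[set p in w]>> ->
  wl2_chi gT hT t (map_tuple fst w) = wl2_chi gT hT t (map_tuple snd w).
Proof.
elim: t w => [|t IHt] w mw.
  exact/wl2_init_marked_isog/matched_marked_isog.
rewrite /wl2_chi /=; congr pair; first exact: IHt.
have step x y : matched <<[set p in (x, y) :: w]>> ->
  [tuple wl2_chi gT hT t (tuple_subst (map_tuple fst w) i x) | i < k] =
  [tuple wl2_chi gT hT t (tuple_subst (map_tuple snd w) i y) | i < k].
  move=> mxy; apply: eq_from_tnth => i; rewrite !tnth_mktuple.
  have := IHt _ (matched_subst (i := i) mxy).
  by rewrite !map_tuple_subst.
have sw : (size w <= k)%N by rewrite size_tuple.
apply/setP=> c; apply/imsetP/imsetP=> -[].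
  move=> x _ ->; have [y mxy] := forth sw mw x; exists y => //.
  exact: step mxy.
move=> y _ ->; have [x mxy] := back sw mw y; exists x => //.
exact/esym/(step _ _ mxy).
Qed.

Lemma matched_nil : matched <<[set p in ([::] : seq (aT * bT))]>>.
Proof.
by rewrite set_nil gen0 => p /set1P ->; rewrite !eqxx /= !square1.
Qed.

(** This is the initial placement: partners are found one at a time from the empty list, which is
    why [forth] also covers lists shorter than [k]. *)
Lemma matched_lift1 (s : seq aT) : (size s <= k)%N ->
  exists2 w : seq (aT * bT), map fst w = s & matched <<[set p in w]>>.
Proof.
elim: s => [_|x s IHs /= ltsk]; first by exists [::] => //; apply: matched_nil.
have [w ws mw] := IHs (ltnW ltsk).
have [|y mxy] := forth _ mw x; first by rewrite -(size_map fst) ws ltnW.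
by exists ((x, y) :: w); rewrite //= ws.
Qed.

Lemma matched_lift2 (s : seq bT) : (size s <= k)%N ->
  exists2 w : seq (aT * bT), map snd w = s & matched <<[set p in w]>>.
Proof.
elim: s => [_|y s IHs /= ltsk]; first by exists [::] => //; apply: matched_nil.
have [w ws mw] := IHs (ltnW ltsk).
have [|x mxy] := back _ mw y; first by rewrite -(size_map snd) ws ltnW.
by exists ((x, y) :: w); rewrite //= ws.
Qed.

Lemma wl2_chi_image t :
  [set wl2_chi gT hT t g | g : k.-tuple aT] =
  [set wl2_chi gT hT t h | h : k.-tuple bT].
Proof.
apply/setP=> c; apply/imsetP/imsetP=> -[].
  move=> g _ ->; have [|w wg mw] := @matched_lift1 g.
    by rewrite size_tuple.
  have sw : size w == k by rewrite -(size_map fst) wg size_tuple.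
  exists (map_tuple snd (Tuple sw)); rewrite // -wl2_chi_matched //.
  by congr wl2_chi; apply: val_inj.
move=> h _ ->; have [|w wh mw] := @matched_lift2 h; first by rewrite size_tuple.
have sw : size w == k by rewrite -(size_map snd) wh size_tuple.
exists (map_tuple fst (Tuple sw)); rewrite // wl2_chi_matched //.
by congr wl2_chi; apply: val_inj.
Qed.

End Pebbles.

(** Exchanging coordinates reduces the [back] condition to a forward extension with the two groups
    interchanged. *)
Lemma matched_swap (aT bT : finGroupType) (s : seq (aT * bT)) :
  matched <<[set p in s]>> -> matched <<[set p in map (fun p => (p.2, p.1)) s]>>.
Proof.
move=> ms.
have fM : {in [set: aT * bT] &,
    {morph (fun p => (p.2, p.1)) : p q / p * q}} by [].
pose f := Morphism fM.
have -> : [set p in map (fun p => (p.2, p.1)) s] = f @* [set p in s].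
  rewrite morphimEsub ?subsetT //; apply/setP=> y; rewrite inE.
  by apply/mapP/imsetP=> -[x xs ->]; exists x => //; rewrite inE in xs *.
rewrite -morphim_gen ?subsetT // => q /morphimP[p _ Rp ->] /=.
by have [-> ->] := ms _ Rp.
Qed.

Lemma matched_cons (k : nat) (aT bT : finGroupType) (s : seq (aT * bT))
    (x : aT) :
    (forall x y : aT, x * y = y * x) -> (forall x y : bT, x * y = y * x) ->
    (forall x : aT, x ^+ 4 = 1) -> (forall x : bT, x ^+ 4 = 1) ->
    (2 * 4 ^ k < #|squares bT|)%N ->
    (4 ^ k * #|squares bT| < #|involutions bT|)%N ->
  (size s <= k)%N -> matched <<[set p in s]>> ->
  exists y, matched <<[set p in (x, y) :: s]>>.
Proof.
move=> aC bC a4 b4 lt1 lt2 sk ms.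
have leR : (#|<<[set p in s]>>| <= 4 ^ k)%N.
  apply: leq_trans (card_gen_exponent4 _ _ _) _; last by rewrite leq_exp2l.
    exact: pair_commute.
  by case=> a b; rewrite pair_expgE a4 b4.
have [||y my] := matched_extension aC bC a4 b4 (R := <<[set p in s]>>%G) x ms.
- by apply: leq_ltn_trans lt1; rewrite leq_mul2l leR.
- by apply: leq_ltn_trans lt2; rewrite leq_mul2r leR orbT.
exists y; rewrite set_cons setUC -joingE -joing_idl.
by apply: matchedS my; rewrite /= joing_idr.
Qed.

(** * Counting squares and 2-torsion in the concrete groups *)

Section Counting.
Variables m1 m2 : nat.
Let T : finGroupType := ('rV['Z_2]_m1 * 'rV['Z_4]_m2)%type.

Lemma Z24_commute (x y : T) : x * y = y * x.
Proof. by case: x y => a b [c d]; congr pair; apply: GRing.addrC. Qed.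

Lemma Z24_squareE (x : T) : x ^+ 2 = (0, x.2 + x.2)%R.
Proof.
case: x => a b; rewrite expgS expg1; congr pair.
apply/rowP=> j; rewrite [LHS]mxE mxE.
by case: (a ord0 j) => -[|[|[]]] // ?; apply: val_inj.
Qed.

Lemma Z24_expg4 (x : T) : x ^+ 4 = 1.
Proof.
rewrite (expgM x 2 2) !Z24_squareE /=; congr pair.
apply/rowP=> j; rewrite !mxE.
by case: (x.2 ord0 j) => -[|[|[|[|[]]]]] // ?; apply: val_inj.
Qed.

(** Vectors with entries 0 or 2, indexed by their support. They are at once the doubles and the
    vectors killed by doubling, so counting subsets settles both cardinalities. *)
Definition twos (A : {set 'I_m2}) : 'rV['Z_4]_m2 :=
  (\row_j if j \in A then 2%:R else 0)%R.

Lemma twos_inj : injective twos.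
Proof.
move=> A B /rowP E; apply/setP=> j; have := E j; rewrite !mxE.
by case: (j \in A); case: (j \in B).
Qed.

Lemma doubles_twos (v : 'rV['Z_4]_m2) :
  (v + v)%R = twos [set j | odd (v ord0 j)].
Proof.
apply/rowP=> j; rewrite !mxE inE.
by case: (v ord0 j) => -[|[|[|[|[]]]]] // ?; apply: val_inj.
Qed.

Lemma double_eq0_twos (v : 'rV['Z_4]_m2) :
  (v + v = 0)%R -> v = twos [set j | v ord0 j != 0%R].
Proof.
move/rowP=> E; apply/rowP=> j; have := E j; rewrite !mxE inE.
by case: (v ord0 j) => -[|[|[|[|[]]]]] // ? /(congr1 val) // _; apply: val_inj.
Qed.

Lemma double_twos A : (twos A + twos A = 0)%R.
Proof.
by apply/rowP=> j; rewrite !mxE; case: ifP => _; apply: val_inj.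
Qed.

Lemma twos_double A :
  twos A = ((\row_j (j \in A)%:R) + (\row_j (j \in A)%:R))%R.
Proof.
by apply/rowP=> j; rewrite !mxE; case: (j \in A); apply: val_inj.
Qed.

Lemma card_twos : #|[set twos A | A : {set 'I_m2}]| = (2 ^ m2)%N.
Proof.
rewrite card_imset; last exact: twos_inj.
by rewrite -cardsT -powersetT card_powerset cardsT card_ord.
Qed.

Lemma card_squares_Z24 : #|squares T| = (2 ^ m2)%N.
Proof.
have inj0 : injective (fun v : 'rV['Z_4]_m2 => (0%R, v) : T) by move=> v w [].
rewrite -card_twos -[RHS](card_imset _ inj0).
apply: eq_card => p; apply/imsetP/imsetP=> -[x].
  move=> _ ->; exists (x.2 + x.2)%R; last exact: Z24_squareE.
  by rewrite doubles_twos imset_f.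
case/imsetP=> A _ -> ->; exists (0%R, \row_j (j \in A)%:R)%R => //.
by rewrite Z24_squareE /= -twos_double.
Qed.

Lemma card_involutions_Z24 : #|involutions T| = (2 ^ m1 * 2 ^ m2)%N.
Proof.
have -> : involutions T = setX setT [set twos A | A : {set 'I_m2}].
  apply/setP=> -[a b]; rewrite !inE Z24_squareE /=.
  apply/eqP/imsetP=> [[E] | [A _ ->]]; last by rewrite double_twos.
  by exists [set j | b ord0 j != 0%R] => //; apply: double_eq0_twos.
rewrite cardsX card_twos cardsT card_mx mul1n.
by congr (_ ^ _ * _)%N; rewrite card_ord.
Qed.

Lemma card_Z24 : #|T| = (2 ^ m1 * 4 ^ m2)%N.
Proof. by rewrite card_prod !card_mx !mul1n !card_ord. Qed.

End Counting.

Lemma isog_card_involutions (aT bT : finGroupType) :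
  [set: aT] \isog [set: bT] -> #|involutions aT| = #|involutions bT|.
Proof.
case/isogP=> f injf imf; rewrite -(card_injm injf) ?subsetT //.
apply: eq_card => y; apply/idP/idP.
  case/morphimP=> x _; rewrite !inE => /eqP x2 ->.
  by rewrite -morphX ?inE // x2 morph1.
rewrite inE => /eqP y2; have: y \in f @* [set: aT] by rewrite imf inE.
case/morphimP=> x Tx _ Ey; rewrite Ey mem_morphim // inE.
by rewrite -(morph_injm_eq1 injf) // morphX // -Ey y2.
Qed.

Theorem mainTheorem12 (n : nat) (hn : 5 <= n) :
  [/\ ~ ([set: Gn n] \isog [set: Hn n]),
      #|Gn n| = #|Hn n|
    & ~ wl2_distinguishes (n %/ 4) (Gn n) (Hn n)].
Proof.
have cardGH : #|Gn n| = #|Hn n|.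
  rewrite !card_Z24 -!(expnM 2 2) -!expnD; congr (2 ^ _)%N.
  lia.
split=> //.
  (* The exponents of 2 are [2n] for [Gn n] and [(n - 2) + (n + 1) = 2n - 1] for [Hn n]. *)
  move/isog_card_involutions; rewrite !card_involutions_Z24 -!expnD.
  move/eqP; rewrite eqn_exp2l // => /eqP; lia.
case=> [//|[t]]; apply; set k := (n %/ 4)%N.
(* The dimensions stay general because each group is the target in one direction; both satisfy the
   two lower bounds on [m3] and [m4]. *)
have extend m1 m2 m3 m4 (s : seq (('rV['Z_2]_m1 * 'rV['Z_4]_m2) *
    ('rV['Z_2]_m3 * 'rV['Z_4]_m4))) x :
    (n - 2 <= m3)%N -> (n <= m4)%N -> (size s <= k)%N ->
    matched <<[set p in s]>> -> exists y, matched <<[set p in (x, y) :: s]>>.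
  move=> le3 le4; apply: matched_cons.
  - exact: Z24_commute.
  - exact: Z24_commute.
  - exact: Z24_expg4.
  - exact: Z24_expg4.
  - rewrite card_squares_Z24 -(expnM 2 2) -expnS ltn_exp2l //; lia.
  (* Comparing exponents leaves [2k < m3]. Since [2k <= n / 2] and [n - 2 <= m3], this follows from
     [n / 2 < n - 2], which is where [5 <= n] enters. *)
  - rewrite card_squares_Z24 card_involutions_Z24 -(expnM 2 2) -!expnD.
    by rewrite ltn_exp2l //; lia.
apply: wl2_chi_image => s sk ms z; first by apply: extend => //; lia.
have [||||x mx] := extend _ _ _ _ (map (fun p => (p.2, p.1)) s) z.
- by lia.
- by lia.
- by rewrite size_map.
- exact: matched_swap.
exists x; have := matched_swap mx; rewrite /= -map_comp.
by rewrite (eq_map (g := id)) ?map_id // => -[].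
Qed.
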